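(* Let $n\ge 2$, let $X=\mathcal{M}(\mathbb{R}^n)$, $\mathcal{M}_+(\mathbb{R}^n)$, $\mathcal{S}(\mathbb{R}^n)$, or $\mathcal{V}(\mathbb{R}^n)$, and let $T:X\to X$ be a rearrangement. Let $\diamondsuit_T:\mathcal{L}^n\to\mathcal{L}^n$ be the induced map $\diamondsuit_TA=\{x:T1_A(x)=1\}$, $A\in\mathcal{L}^n$. (i) The map $\diamondsuit_T$ is monotonic. (ii) If $X=\mathcal{S}(\mathbb{R}^n)$ or $\mathcal{V}(\mathbb{R}^n)$ and $f\in X$, then $$\{x:Tf(x)\ge t\}=\diamondsuit_T\{x:f(x)\ge t\},$$ essentially, for every $t>\operatorname{ess\,inf} f$. Moreover, $T$ is essentially determined by $\diamondsuit_T$, since $$Tf(x)=\max\Big\{\sup\{t\in\mathbb{Q},\ t>\operatorname{ess\,inf} f:\ x\in\diamondsuit_T\{z:f(z)\ge t\}\},\ \operatorname{ess\,inf} f\Big\},$$ essentially (i.e., for $\mathcal{H}^n$-almost all $x\in\mathbb{R}^n$).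
   Context: $\mathcal{H}^n$ is $n$-dimensional Hausdorff (Lebesgue) measure on $\mathbb{R}^n$; ''essentially'' means up to a set of $\mathcal{H}^n$-measure zero. $\mathcal{L}^n$ is the class of $\mathcal{H}^n$-measurable subsets of $\mathbb{R}^n$ of finite $\mathcal{H}^n$-measure, and $1_A$ is the characteristic function of $A$. The supremum of the empty set is $-\infty$. $\mathcal{M}(\mathbb{R}^n)$ (respectively $\mathcal{M}_+(\mathbb{R}^n)$) is the set of real-valued (respectively nonnegative real-valued) $\mathcal{H}^n$-measurable functions on $\mathbb{R}^n$. $\mathcal{S}(\mathbb{R}^n)$ is the set of $f\in\mathcal{M}(\mathbb{R}^n)$ with $\mathcal{H}^n(\{x:f(x)>t\})<\infty$ for all real $t>\operatorname{ess\,inf} f$ (where $\operatorname{ess\,inf} f=-\infty$ is allowed). $\mathcal{V}(\mathbb{R}^n)$ is the set of $f\in\mathcal{M}_+(\mathbb{R}^n)$ with $\mathcal{H}^n(\{x:f(x)>t\})<\infty$ for all $t>0$. A map $T:X\to X$ is equimeasurable if $\mathcal{H}^n(\{x:Tf(x)>t\})=\mathcal{H}^n(\{x:f(x)>t\})$ for all $f\in X$ and $t\in\mathbb{R}$; it is monotonic if for $f,g\in X$, $f\le g$ essentially implies $Tf\le Tg$ essentially; it is a rearrangement if it is equimeasurable and monotonic. (For equimeasurable $T$ the induced map $\diamondsuit_T$ is well defined, i.e. $\diamondsuit_TA\in\mathcal{L}^n$.) A map $\diamondsuit:\mathcal{L}^n\to\mathcal{L}^n$ is monotonic if for $K,L\in\mathcal{L}^n$,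 $K\subset L$ implies $\diamondsuit K\subset\diamondsuit L$, where all inclusions are up to sets of $\mathcal{H}^n$-measure zero. *)

(* Defs.v *)
From HB Require Import structures.
From mathcomp Require Import all_boot all_order all_algebra.
From mathcomp Require Import all_classical all_reals all_analysis.
From mathcomp Require Import measurable_realfun ess_sup_inf.

Set Implicit Arguments.
Unset Strict Implicit.
Unset Printing Implicit Defensive.

Import Order.TTheory GRing.Theory Num.Theory.
Import numFieldNormedType.Exports.

Local Open Scope classical_set_scope.
Local Open Scope ring_scope.

Section lebesgue_outer.
Context {R : realType} {n : nat}.
Local Open Scope ereal_scope.

(* [None] is the empty box: it lets covers be finite, and it is what makes the
   outer measure of the empty set vanish even when [n = 0], where every box
   [Some _] has volume 1. *)
Definition box (p : option ('rV[R]_n * 'rV[R]_n)) : set 'rV[R]_n :=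
  if p is Some (a, b)
  then [set x | forall i, (a ord0 i < x ord0 i <= b ord0 i)%R] else set0.

Definition box_volume (p : option ('rV[R]_n * 'rV[R]_n)) : \bar R :=
  if p is Some (a, b)
  then (\prod_i Num.max 0 (b ord0 i - a ord0 i))%R%:E else 0.

Definition box_cover (A : set 'rV[R]_n) :
    set (nat -> option ('rV[R]_n * 'rV[R]_n)) :=
  [set F | A `<=` \bigcup_k box (F k)].

Definition lebesgue_outer (A : set 'rV[R]_n) : \bar R :=
  ereal_inf [set \sum_(k <oo) box_volume (F k) | F in box_cover A].

Lemma box_volume_ge0 p : 0 <= box_volume p.
Proof.
case: p => [[a b]|//]; rewrite lee_fin; apply: prodr_ge0 => i _.
by rewrite le_max lexx.
Qed.

Lemma lebesgue_outer_ge0 A : 0 <= lebesgue_outer A.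
Proof.
apply: le_ereal_inf_tmp => _ [F _ <-].
by apply: nneseries_ge0 => k _ _; exact: box_volume_ge0.
Qed.

Lemma lebesgue_outer0 : lebesgue_outer set0 = 0.
Proof.
apply/eqP; rewrite eq_le lebesgue_outer_ge0 andbT.
apply: ereal_inf_lbound; exists (fun=> None) => //.
by rewrite eseries0.
Qed.

Lemma le_lebesgue_outer : {homo lebesgue_outer : A B / A `<=` B >-> A <= B}.
Proof.
move=> A B AB; apply/ereal_inf_le_tmp => _ [F BF <-].
by exists F => //; exact: subset_trans AB BF.
Qed.

Lemma lebesgue_outer_sigma_subadditive : sigma_subadditive lebesgue_outer.
Proof.
move=> A; have [[i ioo]|] := pselect (exists i, lebesgue_outer (A i) = +oo).
  rewrite (eseries_pinfty _ _ ioo) ?leey// => k _.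
  by rewrite -ltNye (lt_le_trans _ (lebesgue_outer_ge0 _)).
rewrite -forallNE => Aoo.
suff add2e (e : {posnum R}) : lebesgue_outer (\bigcup_k A k) <=
    \sum_(i <oo) lebesgue_outer (A i) + e%:num%:E.
  by apply/lee_addgt0Pr => _/posnumP[].
rewrite (le_trans _ (epsilon_trick _ _ _))//; last first.
  by move=> k; exact: lebesgue_outer_ge0.
pose P k F := box_cover (A k) F /\
  \sum_(j <oo) box_volume (F j) <=
  lebesgue_outer (A k) + (e%:num / (2 ^ k.+1)%:R)%:E.
have [G PG] : {G & forall k, P k (G k)}.
  apply: (@choice _ _ P) => k.
  have fk : lebesgue_outer (A k) \is a fin_num.
    by rewrite ge0_fin_numE ?lebesgue_outer_ge0// ltey; exact/eqP/Aoo.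
  have ek : (0 < e%:num / (2 ^ k.+1)%:R)%R by [].
  have [_ [F AF <-] /ltW FA] := lb_ereal_inf_adherent ek fk.
  by exists F.
pose V (p : nat * nat) := box_volume (G p.1 p.2).
have V0 p : 0 <= V p by exact: box_volume_ge0.
apply: (@le_trans _ _ (\esum_(p in setT) V p)).
  apply: ereal_inf_lbound => /=.
  have /card_esym/ppcard_eqP[f] := card_nat2.
  exists (fun k => G (f k).1 (f k).2).
    move=> t [i _ /(PG i).1 [j _ Gijt]].
    by exists (f^-1%FUN (i, j)) => //=; rewrite invK ?inE.
  rewrite -(esum_pred_image V f xpredT) ?[fun=> _]set_true//.
  by rewrite image_eq.
rewrite (_ : esum _ _ = \sum_(i <oo) \sum_(j <oo) box_volume (G i j)).
  apply: lee_nneseries => [k _ _|k _]; last exact: (PG k).2.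
  by apply: nneseries_ge0 => j _ _; exact: box_volume_ge0.
pose J : nat -> set (nat * nat) := fun i => [set (i, j) | j in setT].
rewrite (_ : setT = \bigcup_k J k); last first.
  by rewrite predeqE => -[a b]; split => // _; exists a => //; exists b.
rewrite esum_bigcupT//=; last first.
  apply/trivIsetP => i j _ _ ij.
  rewrite predeqE => -[k m] /=; split => //= -[] [_] _ [<-{k} _].
  by move=> [m' _] [] /esym/eqP; rewrite (negbTE ij).
rewrite -(image_id [set: nat]) -fun_true esum_pred_image//; last first.
  by move=> k _; exact: esum_ge0.
apply: eq_eseriesr => /= j _.
rewrite -(esum_pred_image V (pair j) predT)//=; last first.
  by move=> ? ? _ _; exact: (@can_inj _ _ _ snd).
by congr esum; rewrite predeqE => -[a b]; split; move=> [i _ <-]; exists i.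
Qed.

HB.instance Definition _ := isOuterMeasure.Build R 'rV[R]_n lebesgue_outer
  lebesgue_outer0 lebesgue_outer_ge0 le_lebesgue_outer
  lebesgue_outer_sigma_subadditive.

End lebesgue_outer.

(* R^n with the sigma-algebra of all Lebesgue measurable sets (not only the
   Borel sets). *)
Notation Rn R n := (caratheodory_type (@lebesgue_outer R n)).

(* H^n, normalized so as to coincide with the n-dimensional Lebesgue measure. *)
Definition Hn {R : realType} {n : nat} : set (Rn R n) -> \bar R :=
  @lebesgue_outer R n.
HB.instance Definition _ (R : realType) (n : nat) :=
  isMeasure.Build _ (Rn R n) R Hn
    (@caratheodory_measure0 _ _ (@lebesgue_outer R n))
    (@caratheodory_measure_ge0 _ _ (@lebesgue_outer R n))
    (@caratheodory_measure_sigma_additive _ _ (@lebesgue_outer R n)).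

Section rearrangements.
Context {R : realType} {n : nat}.
Implicit Types (f g : Rn R n -> R) (A B K L : set (Rn R n)).
Implicit Types (X : set (Rn R n -> R)) (T : (Rn R n -> R) -> (Rn R n -> R)).

Definition ess_subset A B := \forall x \ae Hn, A x -> B x.
Definition ess_eqset A B := \forall x \ae Hn, A x <-> B x.

Definition essinf f : \bar R := ess_inf Hn (EFin \o f).

Definition classL : set (set (Rn R n)) :=
  [set A | measurable A /\ (Hn A < +oo)%E].

Definition classM : set (Rn R n -> R) := [set f | measurable_fun setT f].

Definition classMplus : set (Rn R n -> R) :=
  [set f | classM f /\ forall x, 0 <= f x].

Definition classS : set (Rn R n -> R) :=
  [set f | classM f /\
    forall t : R, (essinf f < t%:E)%E -> (Hn [set x | t < f x]%R < +oo)%E].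

Definition classV : set (Rn R n -> R) :=
  [set f | classMplus f /\
    forall t : R, 0 < t -> (Hn [set x | t < f x]%R < +oo)%E].

(* In the next three definitions T is a total map, of which only the values on
   X matter; that it maps X into itself is part of [rearrangement]. *)
Definition equimeasurable X T := forall f (t : R), X f ->
  Hn [set x | t < T f x] = Hn [set x | t < f x].

Definition monotonic X T := forall f g, X f -> X g ->
  (\forall x \ae Hn, f x <= g x) -> \forall x \ae Hn, T f x <= T g x.

Definition rearrangement X T :=
  [/\ set_fun X X T, equimeasurable X T & monotonic X T].

Definition induced_map T A : set (Rn R n) := [set x | T \1_A x = 1].

Definition set_monotonic (D : set (Rn R n) -> set (Rn R n)) :=
  forall K L, classL K -> classL L ->
  ess_subset K L -> ess_subset (D K) (D L).

(* The right-hand side of the reconstruction formula, given D in place of the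
   induced map; [ereal_sup set0 = -oo]. *)
Definition reconstruct (D : set (Rn R n) -> set (Rn R n)) f (x : Rn R n) :
    \bar R :=
  Order.max
    (ereal_sup [set (ratr q : R)%:E | q in [set q : rat |
       (essinf f < (ratr q : R)%:E)%E /\ D [set z | ratr q <= f z] x]])
    (essinf f).

Lemma measurable_superlevel f (t : R) : classM f ->
  measurable [set x | t < f x].
Proof.
move=> mf; have := mf measurableT _ (measurable_itv `]t, +oo[).
rewrite setTI; congr measurable; apply/seteqP.
by split=> x /=; rewrite in_itv/= andbT.
Qed.

Lemma measurable_superlevel_ge f (t : R) : classM f ->
  measurable [set x | t <= f x].
Proof.
move=> mf; have := mf measurableT _ (measurable_itv `[t, +oo[).
rewrite setTI; congr measurable; apply/seteqP.
by split=> x /=; rewrite in_itv/= andbT.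
Qed.

Lemma classL_superlevel X f (t : R) : X = classS \/ X = classV -> X f ->
  (essinf f < t%:E)%E -> classL [set x | t <= f x].
Proof.
move=> XSV Xf ft.
have [mf [s st fs]] : classM f /\
    exists2 s, s < t & (Hn [set x | s < f x]%R < +oo)%E.
  case: XSV Xf => -> [].
    move=> mf fS; split => //.
    move: ft fS; case: (essinf f) => [r|//|].
      rewrite lte_fin => rt /(_ ((r + t) / 2)); rewrite lte_fin midf_lt//.
      by move=> /(_ isT); exists ((r + t) / 2) => //; rewrite midf_lt.
    by move=> _ /(_ (t - 1)); rewrite ltNyr => /(_ isT); exists (t - 1) => //;
      rewrite ltrBlDr ltrDl.
  move=> [mf f0] fV; split => //.
  have t0 : 0 < t.
    rewrite -lte_fin; apply: le_lt_trans ft; apply: ereal_sup_ubound => /=.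
    by apply: nearW => x; rewrite lee_fin.
  exists (t / 2); first by rewrite ltr_pdivrMr// ltr_pMr// ltr1n.
  by apply: fV; rewrite divr_gt0.
split; first exact: measurable_superlevel_ge.
apply: le_lt_trans fs; apply: le_measure; rewrite ?inE.
- exact: measurable_superlevel_ge.
- exact: measurable_superlevel.
- by move=> x /=; exact: lt_le_trans.
Qed.

Lemma indic_class X A :
  [\/ X = classM, X = classMplus, X = classS | X = classV] ->
  classL A -> X \1_A.
Proof.
move=> HX [mA Afin].
have mI : classM (\1_A : Rn R n -> R) by exact/measurable_indicP.
have I0 x : 0 <= \1_A x :> R by rewrite indicE.
have If (t : R) : 0 <= t -> (Hn [set x | (t < \1_A x :> R)%R] < +oo)%E.
  move=> t0; apply: le_lt_trans Afin; apply: le_measure; rewrite ?inE//.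
    exact: measurable_superlevel.
  move=> x /=; rewrite indicE; have [/set_mem//|_] := boolP (x \in A).
  by rewrite ltNge t0.
case: HX => -> //; split => //.
  move=> t It; apply: If; rewrite -lee_fin; apply: le_trans (ltW It).
  by apply: ereal_sup_ubound; apply: nearW => x /=; rewrite lee_fin.
by move=> t t0; apply: If; exact: ltW.
Qed.

Lemma classL_induced_map X T A :
  [\/ X = classM, X = classMplus, X = classS | X = classV] ->
  set_fun X X T -> equimeasurable X T -> classL A -> classL (induced_map T A).
Proof.
move=> HX TX eT AL; have XA := indic_class HX AL.
have mT : classM (T \1_A).
  have := TX _ XA; case: HX => -> //= [] //.
  by case.
have mD : measurable (induced_map T A).
  have := mT measurableT _ (@measurable_set1 _ 1); rewrite setTI.
  by congr measurable.
split => //; apply: (@le_lt_trans _ _ (Hn [set x | 2^-1 < T \1_A x])).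
  apply: le_measure; rewrite ?inE//; first exact: measurable_superlevel.
  by move=> x /= ->; rewrite invf_lt1// ltr1n.
rewrite eT//; case: AL => mA; apply: le_lt_trans; apply: le_measure => //.
- by rewrite inE; apply: measurable_superlevel; exact/measurable_indicP.
- by rewrite inE.
move=> x /=; rewrite indicE; have [/set_mem//|_] := boolP (x \in A).
by rewrite ltNge invr_ge0 ler0n.
Qed.

End rearrangements.

(* Main.v *)
Require Import Defs.
From HB Require Import structures.
From mathcomp Require Import all_boot all_order all_algebra.
From mathcomp Require Import all_classical all_reals all_analysis.
From mathcomp Require Import measurable_realfun ess_sup_inf.

Set Implicit Arguments.
Unset Strict Implicit.
Unset Printing Implicit Defensive.

Import Order.TTheory GRing.Theory Num.Theory.
Import numFieldNormedType.Exports.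

Local Open Scope classical_set_scope.
Local Open Scope ring_scope.

(**
Let T be a rearrangement. The induced map is monotonic because 1_K <= 1_L gives
T 1_K <= T 1_L, and T 1_L <= 1 by equimeasurability, so T 1_K = 1 forces
T 1_L = 1 ([induced_map_monotonic]). Two mechanisms carry the rest.

Comparison. If f <= g and t <= s, monotonicity puts {T f >= s} inside
{T g >= t} up to a null set. If moreover {f >= s} = {g >= t} and this set has
finite measure, equimeasurability makes the two image sets have the same
finite measure, so they agree up to a null set
([superlevel_rearrangement]). Equimeasurability only speaks of the sets
{f > t}, and finiteness slightly below t is what allows passing to {f >= t}
by continuity from above.

Zigzag. Let A = {f >= t} with t > ess inf f. T need not commute with any
change of scale, so f and 1_A are linked by a chain of functions of the class,
each comparable with the next and each having A as a superlevel set: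
      f  <=  f + c 1_A  >=  min(f + c 1_A, m 1_A)  <=  m 1_A  >=  1_A
where m = max(t, 1) and c = |t| + 1. Raising f on A first is what handles
t <= 0, for which {m 1_A >= t} is the whole space and not A. Comparing along
the chain gives {T f >= t} = {T 1_A >= 1} = {T 1_A = 1}
([superlevel_induced_map]).

The reconstruction formula then follows by applying this to the countably many
rational t > ess inf f, which determine T f wherever T f >= ess inf f; the
latter holds almost everywhere because T f is equimeasurable with f and again
in the class ([essinf_le_equimeasurable]). Since the formula only involves the
induced map up to null sets at countably many levels, two rearrangements with
the same induced map agree ([reconstruct_eq]).
*)

(** * Extended reals *)

Lemma lte_dense_rat (R : realType) (x y : \bar R) : (x < y)%E ->
  exists q : rat, (x < (ratr q)%:E)%E /\ ((ratr q)%:E < y)%E.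
Proof.
have dense (a b : R) : a < b -> exists q : rat, a < ratr q /\ ratr q < b.
  by move=> /rat_in_itvoo[q]; rewrite in_itv/= => /andP[aq qb]; exists q.
case: x y => [a| |] [b| |] //= ab.
- have [q [aq qb]] := dense a b ab.
  by exists q; rewrite !lte_fin.
- have [|q [aq _]] := dense a (a + 1); first by rewrite ltrDl.
  by exists q; rewrite lte_fin ltry.
- have [|q [_ qb]] := dense (b - 1) b; first by rewrite ltrBlDr ltrDl.
  by exists q; rewrite lte_fin ltNyr.
- by exists 0; rewrite ltNyr ltry.
Qed.

(** The reconstruction formula at a single point, with [a] in the role of the
    essential infimum and [y] in that of the value of T f. If [a] = [y] the
    supremum is over the empty set, and the outer maximum supplies [a]. *)
Lemma maxe_sup_rat (R : realType) (a : \bar R) (y : R) : (a <= y%:E)%E ->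
  y%:E = Order.max (ereal_sup [set (ratr q : R)%:E | q in
    [set q : rat | (a < (ratr q : R)%:E)%E /\ ratr q <= y]]) a.
Proof.
move=> ay; apply/eqP; rewrite eq_le ge_max ay andbT; apply/andP.
split; last first.
  by apply: ge_ereal_sup => _ [q [_ qy] <-]; rewrite lee_fin.
set S := ereal_sup _.
rewrite leNgt; apply/negP => /lte_dense_rat[q []].
rewrite gt_max => /andP[Sq aq] qy.
suff : ((ratr q)%:E < (ratr q)%:E :> \bar R)%E by rewrite ltxx.
apply: le_lt_trans Sq; apply: ereal_sup_ubound; exists q => //=.
by split=> //; rewrite -lee_fin ltW.
Qed.

(** * Sets and functions up to null sets *)

Section measure.
Context d (T : measurableType d) (R : realType).
Variable mu : {measure set T -> \bar R}.
Implicit Types (A B : set T).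

Lemma ae_all_countType (I : countType) (P : I -> T -> Prop) :
  (forall i, \forall x \ae mu, P i x) -> \forall x \ae mu, forall i, P i x.
Proof.
move=> aeP.
have : \forall x \ae mu, forall k, forall i : I, unpickle k = Some i -> P i x.
  apply: ae_foralln => k.
  case: (unpickle k) => [i|]; last exact: aeW.
  by apply: filterS (aeP i) => x Pix j [<-].
by apply: filterS => x Px i; apply: (Px (pickle i)); exact: pickleK.
Qed.

(** Finiteness of the measure is essential: an essential inclusion between
    sets of equal infinite measure need not be an equality. *)
Lemma ae_iff_of_measure_eq A B : measurable A -> measurable B ->
  (\forall x \ae mu, A x -> B x) -> mu A = mu B -> (mu B < +oo)%E ->
  \forall x \ae mu, A x <-> B x.
Proof.
move=> mA mB AB muAB Bfin.
have AB0 : mu (A `\` B) = 0%E.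
  apply/negligibleP; first exact: measurableD.
  by move: AB; congr (mu.-negligible _); apply/seteqP; split => x /=;
    rewrite not_implyE.
have muA : mu A = mu (A `&` B).
  by rewrite (measureDI mu mA mB) [X in (X + _)%E]AB0 add0e.
have BA0 : mu (B `\` A) = 0%E.
  rewrite measureD// setIC -[X in (_ - X)%E]muA muAB subee// ge0_fin_numE//.
have : \forall x \ae mu, B x -> A x.
  suff: mu.-negligible (B `\` A).
    by congr (mu.-negligible _); apply/seteqP; split => x /=;
      rewrite not_implyE.
  by apply/negligibleP => //; exact: measurableD.
by apply: filterS2 AB => x.
Qed.

End measure.

(** * Superlevel sets *)

Section rearrangements.
Context {R : realType} {n : nat}.
Implicit Types (f g : Rn R n -> R) (A B C : set (Rn R n)).
Implicit Types (X : set (Rn R n -> R)) (T : (Rn R n -> R) -> (Rn R n -> R)).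

(** Continuity from above, along levels that increase to [t] from [s]; the
    level of index 0 is [s] itself, so the first set has finite measure. *)
Lemma cvg_superlevel f (s t : R) : classM f -> s < t ->
  (Hn [set x | (s < f x)%R] < +oo)%E ->
  Hn [set x | t - (t - s) / k.+1%:R < f x] @[k --> \oo] -->
  Hn [set x | t <= f x].
Proof.
move=> mf st sfin.
have e0 : 0 < t - s by rewrite subr_gt0.
have -> : [set x | t <= f x] = \bigcap_k [set x | t - (t - s) / k.+1%:R < f x].
  apply/seteqP; split => x /=.
    move=> tfx k _ /=; apply: lt_le_trans tfx.
    by rewrite ltrBlDr ltrDl divr_gt0.
  move=> fx; apply/ler_addgt0Pr => e egt0.
  have [k] := ltr_add_invr (divr_gt0 egt0 e0); rewrite add0r.
  rewrite ltr_pdivlMr// mulrC => ke.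
  by rewrite -lerBlDr ltW// (lt_trans _ (fx k I))// ltrD2l ltrN2.
apply: nonincreasing_cvg_mu.
- by rewrite divr1 opprB addrCA subrr addr0.
- by move=> k; exact: measurable_superlevel.
- by apply: bigcap_measurable => // k _; exact: measurable_superlevel.
- move=> k l kl; apply/subsetPset => x /=; apply: le_lt_trans.
  rewrite lerD2l lerN2 ler_pM2l// lef_pV2 ?posrE// ler_nat; exact: kl.
Qed.

Lemma measure_superlevel_eq f g (s t : R) :
  classM f -> classM g ->
  (forall u, Hn [set x | u < f x] = Hn [set x | u < g x]) ->
  s < t -> (Hn [set x | (s < g x)%R] < +oo)%E ->
  Hn [set x | t <= f x] = Hn [set x | t <= g x].
Proof.
move=> mf mg fg st gfin.
have ffin : (Hn [set x | (s < f x)%R] < +oo)%E by rewrite fg.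
have cf := cvg_superlevel mf st ffin; have := cvg_superlevel mg st gfin.
rewrite (_ : (fun k => _) =
  (fun k => Hn [set x | t - (t - s) / k.+1%:R < f x])).
  move=> cg; exact: (cvg_unique _ cf cg).
by apply/funext => k; rewrite fg.
Qed.

(** * The classes S and V *)

(** A nonnegative function has a nonnegative essential infimum, so the levels
    constrained by S are among those constrained by V. This lets most of the
    argument be carried out in S only. *)
Lemma classV_sub_classS : classV `<=` @classS R n.
Proof.
move=> f [[mf f0] fV]; split=> // t ft; apply: fV.
rewrite -lte_fin; apply: le_lt_trans ft; apply: ereal_sup_ubound => /=.
by apply: nearW => x; rewrite lee_fin.
Qed.

Lemma classS_class X : X = classS \/ X = classV -> X `<=` classS.
Proof. by case=> ->//; exact: classV_sub_classS. Qed.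

Lemma classM_add_indic f A (c : R) : classM f -> measurable A ->
  classM (fun x => f x + c * \1_A x).
Proof.
move=> mf mA; apply: measurable_funD => //.
by apply: measurable_funM; [exact: measurable_cst|exact/measurable_indicP].
Qed.

Lemma superlevel_add_indic_fin f A (c t : R) : classM f -> classL A ->
  (Hn [set x | (t < f x)%R] < +oo)%E ->
  (Hn [set x | (t < f x + c * \1_A x)%R] < +oo)%E.
Proof.
move=> mf [mA Afin] ffin; have mft := measurable_superlevel t mf.
apply: (@le_lt_trans _ _ (Hn ([set x | t < f x] `|` A))).
  apply: le_measure; rewrite ?inE; last 1 first.
  - move=> x /=; rewrite indicE; have [/set_mem Ax _|_] := boolP (x \in A).
      by right.
    by rewrite mulr0 addr0; left.
  - by apply: measurable_superlevel; exact: classM_add_indic.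
  - exact: measurableU.
by apply: le_lt_trans (measureU2 _ _ _) _ => //; exact: lte_add_pinfty.
Qed.

(** Together with [class_min], this keeps the functions of the zigzag in the
    class: T acts only on the class, so the comparison needs it. *)
Lemma class_add_indic X f A (c : R) : X = classS \/ X = classV ->
  X f -> classL A -> 0 <= c -> X (fun x => f x + c * \1_A x).
Proof.
move=> XSV Xf AL c0.
have [mf fS] := classS_class XSV Xf.
have mg := classM_add_indic c mf AL.1.
have cI0 x : 0 <= c * \1_A x by rewrite mulr_ge0// indicE.
case: XSV Xf => -> Xf.
  split => // t gt; apply: superlevel_add_indic_fin => //.
  apply: fS; apply: le_lt_trans gt.
  by apply: le_ess_inf; apply: nearW => x; rewrite lee_fin lerDl.
have [[_ f0] fV] := Xf.
split; first by split=> // x; rewrite addr_ge0.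
by move=> t t0; apply: superlevel_add_indic_fin => //; exact: fV.
Qed.

(** In S the essential infimum of the minimum may be that of either function;
    a level above it exceeds at least one of the two essential infima. *)
Lemma class_min X f g : X = classS \/ X = classV ->
  X f -> X g -> X (fun x => Num.min (f x) (g x)).
Proof.
move=> XSV Xf Xg.
have [mf fS] := classS_class XSV Xf; have [mg gS] := classS_class XSV Xg.
have mh : classM (fun x => Num.min (f x) (g x)) by exact: measurable_minr.
have hf (t : R) : (Hn [set x | (t < f x)%R] < +oo)%E ->
    (Hn [set x | (t < Num.min (f x) (g x))%R] < +oo)%E.
  apply: le_lt_trans.
  apply: le_measure; rewrite ?inE; [exact: measurable_superlevel..|].
  by move=> x /=; rewrite lt_min => /andP[].
have hg (t : R) : (Hn [set x | (t < g x)%R] < +oo)%E ->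
    (Hn [set x | (t < Num.min (f x) (g x))%R] < +oo)%E.
  apply: le_lt_trans.
  apply: le_measure; rewrite ?inE; [exact: measurable_superlevel..|].
  by move=> x /=; rewrite lt_min => /andP[].
case: XSV Xf Xg => -> Xf Xg.
  split=> // t ht.
  have [/fS/hf//|tf] := ltP (essinf f) t%:E.
  have [/gS/hg//|tg] := ltP (essinf g) t%:E.
  suff : (t%:E <= essinf (fun x => Num.min (f x) (g x)))%E by rewrite leNgt ht.
  apply/ess_infP; move/ess_infP : tf => tf; move/ess_infP : tg => tg.
  by apply: filterS2 tf tg => x /=; rewrite !lee_fin le_min => -> ->.
have [[_ f0] fV] := Xf; have [[_ g0] _] := Xg.
split; first by split=> // x; rewrite le_min f0 g0.
by move=> t t0; apply: hf; exact: fV.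
Qed.

Lemma superlevel_fin_lt f (t : R) : classS f -> (essinf f < t%:E)%E ->
  exists2 s : R, s < t & (Hn [set x | (s < f x)%R] < +oo)%E.
Proof.
move=> [_ fS] /lte_dense_rat[q [fq qt]].
by exists (ratr q); [rewrite -lte_fin|exact: fS].
Qed.

(** A level strictly between ess inf g and ess inf f would give a superlevel
    set of [g] of finite measure, as [g] is in S, and of full measure, as the
    one of [f] is conull. It would then be conull, contradicting ess inf g.
    In a space of infinite measure the first two properties already clash. *)
Lemma essinf_le_equimeasurable f g : classS f -> classS g ->
  (forall t : R, Hn [set x | t < g x] = Hn [set x | t < f x]) ->
  (essinf f <= essinf g)%E.
Proof.
move=> [mf fS] [mg gS] gf; rewrite leNgt; apply/negP.
move=> /lte_dense_rat[q [gq qf]].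
have fT : Hn [set x | ratr q < f x] = Hn [set: Rn R n].
  have [r [qr rf]] := lte_dense_rat qf.
  have aer : \forall x \ae Hn, ((ratr r)%:E <= (f x)%:E :> \bar R)%E.
    by apply/ess_infP; exact: ltW.
  have mE := measurable_superlevel (ratr q) mf.
  have EC0 : Hn (setT `\` [set x | ratr q < f x]) = 0%E.
    apply/negligibleP; first exact: measurableD.
    apply: negligibleS aer => x [_ /= /negP]; rewrite -leNgt => fq /=.
    rewrite lee_fin => rf'; move: qr; rewrite lte_fin ltNge.
    by rewrite (le_trans rf' fq).
  have := measureDI Hn measurableT mE.
  by rewrite setTI [X in (X + _)%E]EC0 add0e.
have gT := gf (ratr q); rewrite fT in gT.
have ae : \forall x \ae Hn, [set x | ratr q < g x] x <-> setT x.
  apply: ae_iff_of_measure_eq => //; first exact: measurable_superlevel.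
    exact: aeW.
  by rewrite -[X in (X < _)%E]gT; exact: gS.
suff : ((ratr q)%:E <= essinf g)%E by rewrite leNgt gq.
apply/ess_infP; apply: filterS ae => x /= [_ /(_ I)].
by rewrite lee_fin => /ltW.
Qed.

(** * Images of superlevel sets *)

(** The comparison principle: the inclusion is monotonicity, and it is an
    equality because both sides have the same finite measure. *)
Lemma superlevel_rearrangement X T f g (s t : R) :
  X `<=` classM -> rearrangement X T -> X f -> X g ->
  (forall x, f x <= g x) -> t <= s ->
  (forall x, s <= f x <-> t <= g x) ->
  (exists2 u : R, u < t & (Hn [set x | (u < g x)%R] < +oo)%E) ->
  ess_eqset [set x | s <= T f x] [set x | t <= T g x].
Proof.
move=> XM [TX eT mT] Xf Xg fg ts sftg [u ut ufin].
have [mf mg] := (XM _ Xf, XM _ Xg).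
have [mTf mTg] := (XM _ (TX _ Xf), XM _ (TX _ Xg)).
have uf : (Hn [set x | (u < f x)%R] < +oo)%E.
  apply: le_lt_trans ufin.
  apply: le_measure; rewrite ?inE; [exact: measurable_superlevel..|].
  by move=> x /= /lt_le_trans; apply.
have us := lt_le_trans ut ts.
have muf : Hn [set x | s <= T f x] = Hn [set x | s <= f x].
  by apply: measure_superlevel_eq us uf => // r; exact: eT.
have mug : Hn [set x | t <= T g x] = Hn [set x | t <= g x].
  by apply: measure_superlevel_eq ut ufin => // r; exact: eT.
apply: ae_iff_of_measure_eq; [exact: measurable_superlevel_ge..| | |].
- have := mT _ _ Xf Xg (aeW _ fg); apply: filterS => x /= Tfg sTf.
  exact: le_trans (le_trans ts sTf) Tfg.
- apply: etrans muf (etrans _ (esym mug)); congr (Hn _).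
  by apply/seteqP; split => x /= /sftg.
- apply: le_lt_trans ufin; rewrite [leLHS]mug.
  apply: le_measure; rewrite ?inE;
    [exact: measurable_superlevel_ge|exact: measurable_superlevel|].
  by move=> x /=; exact: lt_le_trans.
Qed.

Lemma ess_eqset_trans A B C :
  ess_eqset A B -> ess_eqset B C -> ess_eqset A C.
Proof. by rewrite /ess_eqset => AB; apply: filterS2 AB => x -> ->. Qed.

Lemma ess_eqset_sym A B : ess_eqset A B -> ess_eqset B A.
Proof. by rewrite /ess_eqset; apply: filterS => x ->. Qed.

(** The upper bound alone identifies {T 1_A >= 1} with {T 1_A = 1}. A lower
    bound is another matter: over a space of infinite measure, equimeasurability
    by itself does not control the set where T 1_A is negative. *)
Lemma rearrangement_indic_le1 X T A :
  [\/ X = classM, X = classMplus, X = classS | X = classV] ->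
  rearrangement X T -> classL A -> \forall x \ae Hn, T \1_A x <= 1.
Proof.
move=> HX [TX eT _] AL; have XA := indic_class HX AL.
have mT : classM (T \1_A).
  have := TX _ XA; case: HX => -> //= [] //.
  by case.
have : Hn [set x | 1 < T \1_A x] = 0%E.
  rewrite eT// (_ : [set x | _] = set0) ?measure0//.
  apply/seteqP; split => x //=.
  by rewrite indicE; case: (x \in A); rewrite ?ltxx ?ltr10.
move=> /negligibleP-/(_ (measurable_superlevel 1 mT)).
by congr (Hn.-negligible _); apply/seteqP; split => x /=;
  rewrite ltNge => /negP.
Qed.

Lemma ess_eqset_induced_map X T A :
  [\/ X = classM, X = classMplus, X = classS | X = classV] ->
  rearrangement X T -> classL A ->
  ess_eqset [set x | 1 <= T \1_A x] (induced_map T A).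
Proof.
rewrite /ess_eqset => HX TR AL.
apply: filterS (rearrangement_indic_le1 HX TR AL) => x T1 /=.
by split=> [T1'|->//]; apply/eqP; rewrite eq_le T1.
Qed.

Lemma induced_map_monotonic X T :
  [\/ X = classM, X = classMplus, X = classS | X = classV] ->
  rearrangement X T -> set_monotonic (induced_map T).
Proof.
move=> HX TR K L KL LL sKL; have [_ _ mT] := TR.
have := mT _ _ (indic_class HX KL) (indic_class HX LL).
have leI : \forall x \ae Hn, \1_K x <= \1_L x :> R.
  move: sKL; rewrite /ess_subset; apply: filterS => x; rewrite !indicE => sKL.
  by have [/set_mem/sKL/mem_set->|] := boolP (x \in K).
move=> /(_ leI); have := rearrangement_indic_le1 HX TR LL.
rewrite /ess_subset.
apply: filterS2 => x L1 KLx; rewrite /induced_map/= => K1.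
by apply/eqP; rewrite eq_le L1 -K1.
Qed.

(** The zigzag: f4 is m 1_A and f3 the minimum in the middle of the chain; each
    step [Sij] is one use of the comparison principle. *)
Lemma superlevel_induced_map X T f (t : R) : X = classS \/ X = classV ->
  rearrangement X T -> X f -> (essinf f < t%:E)%E ->
  ess_eqset [set x | t <= T f x] (induced_map T [set x | t <= f x]).
Proof.
move=> XSV TR Xf ft.
have HX : [\/ X = classM, X = classMplus, X = classS | X = classV].
  by case: XSV; [apply: Or43|apply: Or44].
have XM : X `<=` classM by move=> g /(classS_class XSV)[].
have AL := classL_superlevel XSV Xf ft.
have [u ut ufin] := superlevel_fin_lt (classS_class XSV Xf) ft.
set A := [set x | t <= f x] in AL *.
have IA x : t <= f x -> \1_A x = 1 :> R.
  by move=> tf; rewrite indicE mem_set.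
have IAN x : (t <= f x) = false -> \1_A x = 0 :> R.
  by move=> tf; rewrite indicE memNset//= /A/= tf.
pose m := Num.max t 1; pose c := `|t| + 1.
have tm : t <= m by rewrite le_max lexx.
have m1 : 1 <= m by rewrite le_max lexx orbT.
have m0 : 0 < m by exact: lt_le_trans m1.
have c0 : 0 <= c by rewrite addr_ge0.
have mtc : m <= t + c.
  rewrite /m ge_max lerDl c0/= addrA lerDr.
  by rewrite addrC -lerBlDl sub0r lerNnormlW.
(* With these constants f2 >= m on A, while f2 = f < t off A. *)
pose f2 := fun x => f x + c * \1_A x.
(* The indicator of the empty set stands for the zero function, so that the
   closure of the class under adding c 1_A shows that f4 is in the class. *)
pose f4 := fun x => \1_(set0 : set (Rn R n)) x + m * \1_A x.
pose f3 := fun x => Num.min (f2 x) (f4 x).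
have L0 : classL (set0 : set (Rn R n)) by split=> //; rewrite measure0.
have X2 : X f2 by exact: class_add_indic.
have X4 : X f4 by apply: class_add_indic (ltW m0) => //; exact: indic_class.
have X3 : X f3 by exact: class_min.
have f4E x : f4 x = m * \1_A x by rewrite /f4 indic0 add0r.
have fin2 : exists2 u : R, u < t & (Hn [set x | (u < f2 x)%R] < +oo)%E.
  by exists u => //; apply: superlevel_add_indic_fin ufin => //; exact: XM.
have fin4 : exists2 u : R, u < 1 & (Hn [set x | (u < f4 x)%R] < +oo)%E.
  exists 0 => //; case: AL => mA; apply: le_lt_trans.
  apply: le_measure; rewrite ?inE//.
    by apply: measurable_superlevel; exact: XM.
  move=> x /=; rewrite f4E; have [//|/negbTE/IAN->] := boolP (t <= f x).
  by rewrite mulr0 ltxx.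
have S12 : ess_eqset [set x | t <= T f x] [set x | t <= T f2 x].
  apply: (superlevel_rearrangement XM TR) => //.
  - by move=> x; rewrite lerDl mulr_ge0// indicE.
  - move=> x; rewrite /f2; have [tf|/negbTE tf] := boolP (t <= f x).
      rewrite IA// mulr1; split=> // _.
      by rewrite (le_trans (le_trans tm mtc))// lerD2r.
    by rewrite IAN// mulr0 addr0 tf.
have S23 : ess_eqset [set x | m <= T f3 x] [set x | t <= T f2 x].
  apply: (superlevel_rearrangement XM TR) => //.
  - by move=> x; rewrite ge_min lexx.
  - move=> x; rewrite le_min f4E /f2; have [tf|/negbTE tf] := boolP (t <= f x).
      rewrite IA// !mulr1 lexx andbT.
      have tcf : t + c <= f x + c by rewrite lerD2r.
      by rewrite (le_trans mtc tcf) (le_trans tm (le_trans mtc tcf)).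
    by rewrite IAN// !mulr0 addr0 tf [m <= 0]leNgt m0 andbF.
have S34 : ess_eqset [set x | m <= T f3 x] [set x | 1 <= T f4 x].
  apply: (superlevel_rearrangement XM TR) => //.
  - by move=> x; rewrite ge_min lexx orbT.
  - move=> x; rewrite le_min f4E /f2; have [tf|/negbTE tf] := boolP (t <= f x).
      rewrite IA// !mulr1 lexx andbT m1; split=> // _.
      by apply: le_trans mtc _; rewrite lerD2r.
    by rewrite IAN// !mulr0 [m <= 0]leNgt m0 andbF leNgt ltr01.
have S45 : ess_eqset [set x | 1 <= T \1_A x] [set x | 1 <= T f4 x].
  apply: (superlevel_rearrangement XM TR) => //; first exact: indic_class.
  - move=> x; rewrite f4E; have [tf|/negbTE tf] := boolP (t <= f x).
      by rewrite IA// mulr1.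
    by rewrite IAN// mulr0.
  - move=> x; rewrite f4E; have [tf|/negbTE tf] := boolP (t <= f x).
      by rewrite IA// mulr1 m1 lexx.
    by rewrite IAN// mulr0.
have S5 := ess_eqset_induced_map HX TR AL.
apply: ess_eqset_trans S12 _.
apply: ess_eqset_trans (ess_eqset_sym S23) _.
apply: ess_eqset_trans S34 _.
exact: ess_eqset_trans (ess_eqset_sym S45) S5.
Qed.

(** * Reconstruction from the induced map *)

Lemma essinf_le_rearrangement X T f : X = classS \/ X = classV ->
  rearrangement X T -> X f ->
  \forall x \ae Hn, (essinf f <= (T f x)%:E)%E.
Proof.
move=> XSV [TX eT _] Xf.
have ff : (essinf f <= essinf (T f))%E.
  apply: essinf_le_equimeasurable.
  - exact: classS_class XSV _ Xf.
  - exact: classS_class XSV _ (TX _ Xf).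
  - by move=> t; exact: eT.
apply: filterS (ess_inf_le Hn (EFin \o T f)) => x; exact: le_trans.
Qed.

(** Allowing any [D] that agrees with the induced map up to null sets gives at
    once the formula for T and the fact that T is determined by that map. *)
Lemma reconstruct_eq X T (D : set (Rn R n) -> set (Rn R n)) f :
  X = classS \/ X = classV -> rearrangement X T -> X f ->
  (forall A, classL A -> ess_eqset (induced_map T A) (D A)) ->
  \forall x \ae Hn, (T f x)%:E = reconstruct D f x.
Proof.
move=> XSV TR Xf TD.
have aeq : \forall x \ae Hn, forall q : rat, (essinf f < (ratr q)%:E)%E ->
    D [set z | ratr q <= f z] x <-> ratr q <= T f x.
  apply: ae_all_countType => q.
  have [fq|] := boolP (essinf f < (ratr q)%:E)%E; last by move=> _; exact: aeW.
  have S1 := superlevel_induced_map XSV TR Xf fq.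
  have S2 := TD _ (classL_superlevel XSV Xf fq).
  have := ess_eqset_trans S1 S2.
  by rewrite /ess_eqset; apply: filterS => x /= [].
apply: filterS2 aeq (essinf_le_rearrangement XSV TR Xf) => x Dq fT.
rewrite (maxe_sup_rat fT) /reconstruct; congr (Order.max (ereal_sup _) _).
apply/seteqP; split => _ [q [fq xq] <-]; exists q => //; split=> //.
  by apply/(Dq q fq).
exact/(Dq q fq).
Qed.

End rearrangements.

Theorem theorem4p8 (R : realType) (n : nat) (n_ge2 : (2 <= n)%N)
    (X : set (Rn R n -> R))
    (X_class : [\/ X = classM, X = classMplus, X = classS | X = classV])
    (T : (Rn R n -> R) -> (Rn R n -> R)) (T_rearr : rearrangement X T) :
  set_monotonic (induced_map T) /\
  (X = classS \/ X = classV ->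
    [/\ forall f, X f -> forall t : R, (essinf f < t%:E)%E ->
          ess_eqset [set x | t <= T f x] (induced_map T [set x | t <= f x]),
        forall f, X f ->
          \forall x \ae Hn, (T f x)%:E = reconstruct (induced_map T) f x
      & forall T', rearrangement X T' ->
          (forall A, classL A -> ess_eqset (induced_map T A) (induced_map T' A)) ->
          forall f, X f -> \forall x \ae Hn, T f x = T' f x]).
Proof.
split; first exact: induced_map_monotonic X_class T_rearr.
have ess_refl D (A : set (Rn R n)) : ess_eqset (D A) (D A) by exact: aeW.
move=> XSV; split=> [f Xf t ft|f Xf|T' T'R TT' f Xf].
- exact: superlevel_induced_map XSV T_rearr Xf ft.
- by apply: reconstruct_eq XSV T_rearr Xf _.
have ET := reconstruct_eq XSV T_rearr Xf TT'.
have ET' : \forall x \ae Hn, (T' f x)%:E = reconstruct (induced_map T') f x.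
  by apply: reconstruct_eq XSV T'R Xf _.
by apply: filterS2 ET ET' => x /= <- [].
Qed.
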